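(* Let $k\geq 2$ be an integer, $\mathbf{a}=(a_1,\dots,a_{k-1}),\ \mathbf{b}=(b_1,\dots,b_{k-1})\in\mathbb{N}^{k-1}$, and let $f_{\mathbf{a},\mathbf{b}}:\mathbb{N}\to\mathbb{N}$ be defined by $$f_{\mathbf{a},\mathbf{b}}(n)=\begin{cases}a_in+b_i, & n\equiv i \pmod k,\ 1\le i\le k-1,\\ n/k, & n\equiv 0\pmod k.\end{cases}$$ Assume that (i) $a_i$ is relatively prime to $k$ for every $1\le i\le k-1$, and (ii) for every $n\in\mathbb{N}$ the set $\{n,f_{\mathbf{a},\mathbf{b}}(n),\dots,f_{\mathbf{a},\mathbf{b}}^{k-1}(n)\}$ includes a multiple of $k$. Then $f_{\mathbf{a},\mathbf{b}}$ satisfies the totally uniqueness condition with respect to the partition of $\mathbb{N}$ into $X_i=\{n\in\mathbb{N}\mid n\equiv i\pmod k\}$, $1\le i\le k$. In particular, for all odd numbers $q,d\in\mathbb{N}$, the $qx+d$-function $f_{q,d}:\mathbb{N}\to\mathbb{N}$, given by $f_{q,d}(n)=qn+d$ for $n$ odd and $f_{q,d}(n)=n/2$ for $n$ even, satisfies the totally uniqueness condition with respect to the partition of $\mathbb{N}$ into $X_1=\{\text{odd } n\}$ and $X_2=\{\text{even } n\}$.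
   Context: $\mathbb{N}$ is the set of positive integers. Totally uniqueness condition: let $f:X\to X$ be a map on a countable set $X$ and $X=X_1\sqcup\cdots\sqcup X_k$ a fixed partition such that each $f|_{X_i}$ is injective. For $x\in X$ and $j\in\mathbb{N}$ let $i_j\in\{1,\dots,k\}$ be the unique index with $f^{j-1}(x)\in X_{i_j}$ ($f^0=\mathrm{id}_X$), and put $\hat{x}=(i_1,i_2,i_3,\dots)\in\{1,\dots,k\}^{\mathbb{N}}$. The map $f$ satisfies the totally uniqueness condition (with respect to this partition) if $X\ni x\mapsto\hat{x}\in\{1,\dots,k\}^{\mathbb{N}}$ is injective. *)

(* Defs.v *)
From HB Require Import structures.
From mathcomp Require Import all_boot.

Set Implicit Arguments.
Unset Strict Implicit.
Unset Printing Implicit Defensive.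

(* Throughout, the paper's natural numbers are the positive ones, and
   i : 'I_k stands for the paper's index i.+1 in {1, ..., k}. *)
Notation posn := {n : nat | 0 < n}.

Section TotallyUniqueness.

Variables (X : countType) (k : nat).

(* The parts X_i may be empty. *)
Definition is_partition (P : 'I_k -> pred X) : Prop :=
  forall x, exists! i, x \in P i.

Fact is_partition_ex P (hP : is_partition P) x : exists i, x \in P i.
Proof. by case: (hP x) => i [Pix _]; exists i. Qed.

Definition part_index P (hP : is_partition P) (x : X) : 'I_k :=
  xchoose (is_partition_ex hP x).

(* The sequence is indexed from 0, so f is iterated j times rather than
   j - 1 times. *)
Definition itinerary (f : X -> X) P (hP : is_partition P) (x : X) :
  nat -> 'I_k := fun j => part_index hP (iter j f x).

(* The standing assumptions (the P i partition X and f is injective on each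
   P i) are part of the condition. *)
Definition totally_unique (f : X -> X) (P : 'I_k -> pred X) : Prop :=
  exists hP : is_partition P,
    (forall i, {in P i &, injective f}) /\ injective (itinerary f hP).

End TotallyUniqueness.

Definition posn1 : posn := exist (fun n => 0 < n) 1 isT.

(* a_i is the entry of rank i.-1 of the tuple a; the default value posn1 is
   never reached when 2 <= k. *)
Definition fab_nat k (a b : k.-1.-tuple posn) (n : nat) : nat :=
  if k %| n then n %/ k
  else val (nth posn1 a (n %% k).-1) * n + val (nth posn1 b (n %% k).-1).

Fact fab_nat_gt0 k (a b : k.-1.-tuple posn) (n : posn) :
  0 < fab_nat a b (val n).
Proof.
case: n => n /= n0; rewrite /fab_nat; case: ifP => [kn | _].
  by rewrite divn_gt0 ?(dvdn_gt0 n0 kn) // dvdn_leq.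
by rewrite addn_gt0 (valP (nth posn1 b _)) orbT.
Qed.

Definition fab k (a b : k.-1.-tuple posn) (n : posn) : posn :=
  exist (fun m => 0 < m) (fab_nat a b (val n)) (fab_nat_gt0 a b n).

Definition residue_part k (i : 'I_k) : pred posn :=
  [pred n | val n == i.+1 %[mod k]].

Definition fqd_nat (q d : posn) (n : nat) : nat :=
  if odd n then val q * n + val d else n %/ 2.

Fact fqd_nat_gt0 (q d n : posn) : 0 < fqd_nat q d (val n).
Proof.
case: n => n /= n0; rewrite /fqd_nat; case: ifP => [_ | on].
  by rewrite addn_gt0 (valP d) orbT.
by rewrite divn_gt0 //; case: n n0 on => [|[|n]].
Qed.

Definition fqd (q d : posn) (n : posn) : posn :=
  exist (fun m => 0 < m) (fqd_nat q d (val n)) (fqd_nat_gt0 q d n).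

Definition parity_part (i : 'I_2) : pred posn :=
  [pred n | if i == ord0 then odd (val n) else ~~ odd (val n)].

(* Main.v *)
(* Suppose x and y have the same itinerary. At a non-multiple of k, one step of
   f multiplies the difference x - y by some a_i prime to k; at a multiple of k
   it divides the difference by k. So congruence of f(x) and f(y) modulo k^N
   pulls back to x and y, with a gain of one power of k at each division. As
   every orbit meets the multiples of k, x and y are congruent modulo every
   power of k. *)
Require Import Defs.
From mathcomp Require Import all_boot.

Set Implicit Arguments.
Unset Strict Implicit.
Unset Printing Implicit Defensive.

Lemma eqn_mod_pmul2l (c m x y : nat) :
  coprime m c -> (c * x == c * y %[mod m]) = (x == y %[mod m]).
Proof.
move=> co_mc; wlog le_yx: x y / y <= x => [wlog_le|].
  case/orP: (leq_total y x) => [|le_xy]; first exact: wlog_le.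
  by rewrite eq_sym wlog_le // eq_sym.
by rewrite !eqn_mod_dvd ?leq_mul // -mulnBr Gauss_dvdr.
Qed.

Lemma eq_mod_expn (k x y : nat) :
  1 < k -> (forall N, x = y %[mod k ^ N]) -> x = y.
Proof.
move=> k_gt1 eq_xy.
(* The modulus [k ^ (x + y)] exceeds both numbers, so each is its own residue. *)
have := eq_xy (x + y); rewrite !modn_small //.
  exact: leq_ltn_trans (leq_addl x y) (ltn_expl _ k_gt1).
exact: leq_ltn_trans (leq_addr y x) (ltn_expl _ k_gt1).
Qed.

Lemma residue_part_partition k : 0 < k -> is_partition (@residue_part k).
Proof.
(* Index [i] stands for the residue of [i.+1], so the part of [n.+1] has index [n %% k]. *)
move=> k_gt0 [[//|n] n_gt0]; exists (Ordinal (ltn_pmod n k_gt0)); split.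
  by rewrite inE /= -addn1 -[in X in _ == X %[mod _]]addn1 modnDml.
move=> i; rewrite inE /= => eq_ni; apply: val_inj => /=.
rewrite -[RHS](modn_small (ltn_ord i)); apply/eqP.
by rewrite -(eqn_modDr 1) !addn1.
Qed.

Lemma itinerary_part (X : countType) k (f : X -> X) (P : 'I_k -> pred X)
    (hP : is_partition P) x j :
  iter j f x \in P (itinerary f hP x j).
Proof. exact: xchooseP (is_partition_ex hP _). Qed.

Section PiecewiseAffine.

(** A common setting for [fab] and [fqd], with coefficients indexed by the residue itself. *)
Variables (k : nat) (f : posn -> posn) (a b : nat -> nat).
Hypothesis k_gt1 : 1 < k.
Hypothesis f_dvd : forall n, k %| val n -> val (f n) = val n %/ k.
Hypothesis f_ndvd : forall n, ~~ (k %| val n) ->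
  val (f n) = a (val n %% k) * val n + b (val n %% k).
Hypothesis co_a : forall r, 0 < r < k -> coprime (a r) k.
Hypothesis hit : forall n, exists j, k %| val (iter j f n).

(** The boolean in the exponent records the gain: a division by [k] yields one more power, while a
    factor prime to [k] just cancels modulo [k ^ N]. *)
Lemma eq_mod_step N x y :
    val x = val y %[mod k] -> val (f x) = val (f y) %[mod k ^ N] ->
  val x = val y %[mod k ^ ((k %| val x) + N)].
Proof.
move=> eq_xy; have kxy : (k %| val x) = (k %| val y) by rewrite /dvdn eq_xy.
have [kx|kx] := boolP (k %| val x).
  have ky : k %| val y by rewrite -kxy.
  rewrite !f_dvd // => eq_q.
  by rewrite -(divnK kx) -(divnK ky) add1n expnSr -!muln_modl eq_q.
rewrite !f_ndvd -?kxy // -eq_xy add0n => /eqP.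
rewrite eqn_modDr eqn_mod_pmul2l; first by move/eqP.
by rewrite coprimeXl // coprime_sym co_a // lt0n kx ltn_pmod // ltnW.
Qed.

(** Induction on [N], then on a time [j] at which the orbit of [x] meets a multiple of [k]. For
    [j = 0] the division lifts [N] to [N.+1]; otherwise the congruence modulo [k ^ N.+1] holds for
    the images and is pulled back. *)
Lemma eq_itinerary_mod_expn N x y :
    (forall j, val (iter j f x) = val (iter j f y) %[mod k]) ->
  val x = val y %[mod k ^ N].
Proof.
elim: N x y => [|N IHN] x y; first by rewrite expn0 !modn1.
have [j] := hit x; elim: j x y => [|j IHj] x y kx eq_xy.
all: have eq_fxy i : val (iter i f (f x)) = val (iter i f (f y)) %[mod k]
       by rewrite -!iterSr.
  by have := eq_mod_step (eq_xy 0) (IHN _ _ eq_fxy); rewrite [k %| _]kx.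
rewrite iterSr in kx; have := eq_mod_step (eq_xy 0) (IHj _ _ kx eq_fxy).
move/(congr1 (modn^~ (k ^ N.+1))).
by rewrite !modn_dvdm // dvdn_exp2l // leq_addl.
Qed.

(** Equal images are congruent modulo every power of [k], and a single pullback step keeps this. *)
Lemma inj_mod x y : val x = val y %[mod k] -> f x = f y -> x = y.
Proof.
move=> eq_xy eq_fxy; apply/val_inj/(eq_mod_expn k_gt1) => N.
have := @eq_mod_step N x y eq_xy (congr1 (fun n => val n %% _) eq_fxy).
by move/(congr1 (modn^~ (k ^ N))); rewrite !modn_dvdm // dvdn_exp2l // leq_addl.
Qed.

Lemma totally_unique_piecewise_affine (P : 'I_k -> pred posn) :
  (forall i, P i =1 residue_part i) -> totally_unique f P.
Proof.
move=> P_res; have mod_eq i x y : x \in P i -> y \in P i ->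
    val x = val y %[mod k].
  by rewrite !unfold_in !P_res => /eqP -> /eqP ->.
have hP : is_partition P.
  move=> x; have [i [Pix uniq_i]] := residue_part_partition (ltnW k_gt1) x.
  exists i; split=> [|j]; rewrite unfold_in P_res //; exact: uniq_i.
exists hP; split=> [i x y Pix Piy|x y eq_xy]; first exact/inj_mod/(mod_eq i).
apply/val_inj/(eq_mod_expn k_gt1) => N; apply: eq_itinerary_mod_expn => j.
apply: (mod_eq (itinerary f hP x j)); first exact: itinerary_part.
by rewrite eq_xy itinerary_part.
Qed.

End PiecewiseAffine.

Theorem proposition4p6 :
  (forall (k : nat) (a b : k.-1.-tuple posn),
     2 <= k ->
     (forall i : 'I_k.-1, coprime (val (tnth a i)) k) ->
     (forall n : posn, exists2 j : nat, j < k & k %| val (iter j (fab a b) n)) ->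
     totally_unique (fab a b) (@residue_part k))
  /\
  (forall q d : posn,
     odd (val q) -> odd (val d) ->
     totally_unique (fqd q d) parity_part).
Proof.
split=> [k a b k_gt1 co_a hit|q d odd_q odd_d].
  apply: (@totally_unique_piecewise_affine k _
    (fun r => val (nth posn1 a r.-1)) (fun r => val (nth posn1 b r.-1))) => //.
  - by move=> n kn /=; rewrite /fab_nat kn.
  - by move=> n kn /=; rewrite /fab_nat (negPf kn).
  - move=> r /andP[r_gt0 r_lt].
    have lt_r : r.-1 < k.-1 by rewrite -ltnS !prednK // ltnW.
    by have := co_a (Ordinal lt_r); rewrite (tnth_nth posn1).
  - by move=> n; have [j _ kj] := hit n; exists j.
apply: (@totally_unique_piecewise_affine 2 _ (fun=> val q) (fun=> val d)) => //.
- by move=> n; rewrite dvdn2 /= /fqd_nat => /negPf ->.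
- by move=> n; rewrite dvdn2 negbK /= /fqd_nat => ->.
- by rewrite coprimen2.
- move=> n; have [odd_n|even_n] := boolP (odd (val n)); last first.
    by exists 0; rewrite dvdn2.
  (* For odd [n], the image [q * n + d] is a sum of two odd numbers. *)
  by exists 1; rewrite dvdn2 /= /fqd_nat odd_n oddD oddM odd_q odd_n odd_d.
(* Index 0 is residue 1 (odd), and index 1 is residue 2, that is 0 (even). *)
- move=> i n; rewrite -[RHS]/(val n %% 2 == i.+1 %% 2) !modn2.
  by case: i => [[|[|//]] lt_i2]; rewrite /parity_part /=; case: odd.
Qed.
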